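(* Let $G$ be a simple graph on $n \geq 2$ vertices and let $\bar{G}$ be its complement. Then $$\lambda(G) + \lambda(\bar{G}) \geq 1,$$ with equality if and only if $G$ or $\bar{G}$ is isomorphic to the join of a single (isolated) vertex and a disconnected graph of order $n-1$.
   Context: For a simple graph $G$ on $n$ vertices, $L(G) = D(G) - A(G)$ is its Laplacian matrix, where $A(G)$ is the adjacency matrix and $D(G)$ the diagonal matrix of vertex degrees. Its eigenvalues are $0 = \lambda_1(G) \leq \lambda_2(G) \leq \cdots \leq \lambda_n(G)$, and $\lambda(G) := \lambda_2(G)$ is the algebraic connectivity. The join of two graphs is their disjoint union together with all edges between a vertex of the first and a vertex of the second. *)

(* Defs.v *)
From HB Require Import structures.
From mathcomp Require Import all_boot all_order all_algebra.
From mathcomp Require Import reals.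
From Stdlib Require Import ClassicalEpsilon.
Set Implicit Arguments. Unset Strict Implicit. Unset Printing Implicit Defensive.
Import Order.TTheory GRing.Theory Num.Theory.
Local Open Scope ring_scope.

Definition simple_graph (T : finType) (e : rel T) : Prop :=
  symmetric e /\ irreflexive e.

Definition compl_graph (T : finType) (e : rel T) : rel T :=
  fun x y => (x != y) && ~~ e x y.

Definition connected_graph (T : finType) (e : rel T) : Prop :=
  forall x y : T, connect e x y.

Definition graph_join (T1 T2 : finType) (e1 : rel T1) (e2 : rel T2)
  : rel (T1 + T2)%type :=
  fun u v => match u, v with
             | inl a, inl b => e1 a b
             | inr a, inr b => e2 a b
             | _, _ => true
             end.

Definition graph_iso (T1 T2 : finType) (e1 : rel T1) (e2 : rel T2) : Prop :=
  exists f : T1 -> T2, bijective f /\ forall x y, e2 (f x) (f y) = e1 x y.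

Definition K1 : rel unit := fun _ _ => false.

Definition join_K1_disconnected (n : nat) (e : rel 'I_n) : Prop :=
  exists H : rel 'I_n.-1,
    simple_graph H /\ ~ connected_graph H /\ graph_iso e (graph_join K1 H).

Definition laplacian (R : pzRingType) (n : nat) (e : rel 'I_n) : 'M[R]_n :=
  \matrix_(i, j) ((if i == j then (#|[set k | e i k]|)%:R else 0)
                  - (e i j)%:R).

(* The eigenvalues of A, listed in nondecreasing order with multiplicity,
   i.e. the sorted sequence s of roots of the characteristic polynomial:
   char_poly A = prod_(x <- s) (X - x).  (Such s exists and is unique
   for real symmetric matrices.) *)
Definition spectrum (R : realType) (n : nat) (A : 'M[R]_n) : seq R :=
  epsilon (inhabits [::])
    (fun s : seq R => sorted <=%R s /\
                      char_poly A = \prod_(x <- s) ('X - x%:P)).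

(* Algebraic connectivity lambda_2(G) (second smallest Laplacian eigenvalue;
   index 1 in 0-based numbering). *)
Definition alg_conn (R : realType) (n : nat) (e : rel 'I_n) : R :=
  (spectrum (laplacian R e))`_1.

(* Main.v *)
Require Import Defs.
From HB Require Import structures.
From mathcomp Require Import all_boot all_order all_algebra perm.
From mathcomp Require Import reals complex ring lra.
From Stdlib Require Import ClassicalEpsilon.
Import Order.TTheory GRing.Theory Num.Theory.
Local Open Scope ring_scope.

(* Let a and b be the algebraic connectivities of G and of its complement.  If
   a >= 1 there is nothing to prove but the case of equality a = 1, b = 0: then
   the complement is disconnected, so G is a join, and the eigenvalue 1 forces
   one side of the join to be a single vertex.

   If a, b < 1, let x be an eigenvector for a.  Every neighbour of a maximum p
   of x has positive value and every neighbour of a minimum s has negative value,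
   so p and s have distance at least 3 in G; likewise for the extreme points
   q, r of an eigenvector in the complement.  This makes p q r s an induced path
   of G.  Translate x so that it takes the values h and -h at q and r; this only
   increases the sum of squares.  A vertex adjacent to both {p, q} and {r, s}
   contributes at least 2 h^2 to the Dirichlet energy minus a times the sum of
   squares, any other one at least - a h^2 / (1 - a).  Every vertex off the path
   is of the first kind in G or in the complement, and comparing the two counts
   gives a + b > 1. *)

(** * Diagonalization of real symmetric matrices *)

Lemma symmetric_diagonalizable (R : rcfType) n (A : 'M[R]_n) : A^T = A ->
  exists2 P : 'M[R]_n, P \in unitmx &
    exists d : 'rV[R]_n, P *m A = diag_mx d *m P.
Proof.
(* Over the complex numbers [A] is hermitian, hence similar to a real diagonal matrix;
   [real_similar] brings this similarity of two real matrices back to a real [Q]. *)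
move=> Asym; pose f := real_complex R; pose AC := map_mx f A.
have ACreal : AC \is a mxOver Num.real.
  by apply/mxOverP => i j; rewrite mxE; apply/complex_realP; exists (A i j).
have ACherm : AC \is hermsymmx.
  apply: realsym_hermsym => //; apply/is_hermitianmxP.
  by rewrite expr0 scale1r map_mx_id // map_trmx Asym.
have dreal := hermitian_spectral_diag_real ACherm.
have /hermitian_normalmx/orthomx_spectralP AE := ACherm.
set D := spectral_diag AC in AE dreal; set U := spectralmx AC in AE.
have Uunit : U \in unitmx by exact: spectral_unit.
have simC : similar_in unitmx AC (diag_mx D).
  exists U => //; apply/similarP => //.
  by rewrite {1}AE !mulmxA mulmxV // mul1mx.
have Dreal : diag_mx D \is a mxOver Num.real.
  apply/mxOverP => i j; rewrite mxE; case: eqP => _; last exact: real0.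
  exact: (mxOverP dreal).
have [Q] := real_similar simC ACreal Dreal.
rewrite inE => /andP[/= Qreal Qunit] /(similarP Qunit) QE.
have mapRe m (M : 'M_(m, n)) : M \is a mxOver Num.real ->
    M = map_mx f (map_mx (@complex.Re R) M).
  move=> /mxOverP Mr; apply/matrixP => i j; rewrite !mxE.
  by rewrite /f RRe_real.
exists (map_mx (@complex.Re R) Q).
  by rewrite -(map_unitmx f) -mapRe.
exists (map_mx (@complex.Re R) D).
apply: (@map_mx_inj _ _ f).
by rewrite !map_mxM map_diag_mx -!mapRe.
Qed.

Lemma similar_char_poly (F : fieldType) n (P A B : 'M[F]_n) :
  P \in unitmx -> P *m A = B *m P -> char_poly A = char_poly B.
Proof.
move=> Punit PAB.
have detP0 : (\det P)%:P != 0 by rewrite polyC_eq0 -unitfE -unitmxE.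
apply: (mulfI detP0); rewrite [RHS]mulrC -det_map_mx -!det_mulmx.
congr (\det _); rewrite /char_poly_mx mulmxBr mulmxBl -!map_mxM PAB.
by rewrite scalar_mxC.
Qed.

(** The specification of [epsilon] becomes available once a sorted list of roots exists; sorting the
    diagonal found above provides one. Two lists of roots agree up to a permutation, and permuting
    the rows of [P] by it aligns the eigenbasis with [spectrum A]. *)
Lemma spectrum_eigenbasis (R : realType) n (A : 'M[R]_n) : A^T = A ->
  [/\ sorted <=%R (spectrum A), size (spectrum A) = n &
  exists2 P : 'M[R]_n, P \in unitmx &
    forall i j, (P *m A) i j = (spectrum A)`_i * P i j].
Proof.
move=> /symmetric_diagonalizable[P Punit [d PA]].
pose t := [tuple d 0 i | i < n].
have charA : char_poly A = \prod_(x <- t) ('X - x%:P).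
  rewrite (similar_char_poly _ _ _ _ _ Punit PA) char_poly_trig ?diag_mx_is_trig //.
  rewrite big_map big_enum /=; apply: eq_bigr => i _.
  by rewrite mxE eqxx mulr1n.
have [] : sorted <=%R (spectrum A) /\
    char_poly A = \prod_(x <- spectrum A) ('X - x%:P).
  apply: (epsilon_spec (inhabits [::])
    (fun s : seq R => sorted <=%R s /\ char_poly A = \prod_(x <- s) ('X - x%:P))).
  exists (sort <=%R t); split; first exact: sort_le_sorted.
  by rewrite charA; apply: perm_big; rewrite perm_sym perm_sort.
move=> ssort; rewrite charA => /prod_XsubC_eq; rewrite perm_sym.
move=> /tuple_permP[p sE]; split=> //.
  by rewrite sE size_tuple.
exists (row_perm p P); first by rewrite row_permE unitmx_mul unitmx_perm.
move=> i j; rewrite {1}row_permE -mulmxA PA mul_diag_mx -row_permE !mxE.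
congr (_ * _); rewrite sE (nth_map i) ?size_enum_ord // nth_ord_enum.
by rewrite tnth_map tnth_ord_tuple.
Qed.

(** * Laplacian eigenvectors as functions on the vertices *)

Definition lap_eigen {R : pzRingType} {T : finType} (e : rel T) (c : R)
    (x : T -> R) : Prop :=
  forall i, \sum_(j | e i j) (x i - x j) = c * x i.

(** An eigenvector orthogonal to the constants. By [alg_conn_eigen] and [alg_conn_le] the algebraic
    connectivity is the least [c] that has one. *)
Definition zero_sum_eigen {R : pzRingType} {T : finType} (e : rel T) (c : R)
    (x : T -> R) : Prop :=
  [/\ exists i, x i != 0, \sum_i x i = 0 & lap_eigen e c x].

Section Eigen.
Variables (R : realFieldType) (T : finType) (e : rel T).
Hypothesis sym_e : symmetric e.

(** Pair the eigenvalue equation with [x] and symmetrize by exchanging the ends of each edge. The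
    factor 2 appears because the sum runs over ordered pairs. *)
Lemma lap_eigen_energy (c : R) (x : T -> R) : lap_eigen e c x ->
  \sum_i \sum_(j | e i j) (x i - x j) ^+ 2 = 2 * (c * \sum_i x i ^+ 2).
Proof.
move=> ex; pose S := \sum_i \sum_(j | e i j) x i * (x i - x j).
have -> : c * \sum_i x i ^+ 2 = S.
  rewrite mulr_sumr; apply: eq_bigr => i _.
  by rewrite -mulr_sumr ex; ring.
have SE : S = - \sum_i \sum_(j | e i j) x j * (x i - x j).
  rewrite /S (exchange_big_dep predT) //= -sumrN; apply: eq_bigr => i _.
  rewrite -sumrN; apply: eq_big => [j|j _]; first by rewrite sym_e.
  by ring.
rewrite mulrDl !mul1r [X in X + _]SE addrC {1}/S -sumrB.
apply: eq_bigr => i _; rewrite -sumrB; apply: eq_bigr => j _.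
by ring.
Qed.

Lemma sum_sqr_gt0 (x : T -> R) : (exists i, x i != 0) -> 0 < \sum_i x i ^+ 2.
Proof.
move=> [i xi0]; rewrite (bigD1 i) //= ltr_pwDl //.
  by rewrite lt_neqAle sqr_ge0 eq_sym sqrf_eq0 xi0.
by apply: sumr_ge0 => j _; exact: sqr_ge0.
Qed.

Lemma lap_eigen_ge0 (c : R) (x : T -> R) : (exists i, x i != 0) ->
  lap_eigen e c x -> 0 <= c.
Proof.
move=> /sum_sqr_gt0 x2 /lap_eigen_energy energy.
have : 0 <= 2 * (c * \sum_i x i ^+ 2).
  rewrite -energy; apply: sumr_ge0 => i _.
  by apply: sumr_ge0 => j _; exact: sqr_ge0.
by rewrite pmulr_rge0 // pmulr_lge0.
Qed.

Lemma lap_eigen0_edge (x : T -> R) i j : lap_eigen e 0 x -> e i j -> x i = x j.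
Proof.
move=> /lap_eigen_energy; rewrite mul0r mulr0 => energy eij.
apply/eqP; rewrite -subr_eq0 -sqrf_eq0; apply/eqP.
have ge0 k : 0 <= \sum_(l | e k l) (x k - x l) ^+ 2.
  by apply: sumr_ge0 => l _; exact: sqr_ge0.
have zi := psumr_eq0P (fun k _ => ge0 k) energy (i := i) isT.
exact: (psumr_eq0P (fun l _ => sqr_ge0 (x i - x l)) zi (i := j) eij).
Qed.

Lemma lap_eigen_sum0 (c : R) (x : T -> R) : c != 0 -> lap_eigen e c x ->
  \sum_i x i = 0.
Proof.
move=> c0 ex; apply: (mulfI c0); rewrite mulr0 mulr_sumr.
under eq_bigr do rewrite -ex.
have : \sum_i \sum_(j | e i j) (x i - x j) =
       - \sum_i \sum_(j | e i j) (x i - x j).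
  rewrite {1}(exchange_big_dep predT) //= -sumrN; apply: eq_bigr => i _.
  rewrite -sumrN; apply: eq_big => [j|j _]; first by rewrite sym_e.
  by ring.
lra.
Qed.

End Eigen.

(** * Algebraic connectivity as the least eigenvalue on zero-sum vectors *)

Lemma mulmx_laplacian (R : pzRingType) n (e : rel 'I_n) (v : 'rV[R]_n) i :
  symmetric e -> (v *m laplacian R e) 0 i = \sum_(j | e i j) (v 0 i - v 0 j).
Proof.
move=> sym_e; rewrite mxE; under eq_bigr do rewrite mxE mulrBr.
rewrite sumrB (bigD1 i) //= eqxx big1 ?addr0 => [|j /negbTE->]; last first.
  by rewrite mulr0.
rewrite sumrB sumr_const mulr_natr; congr (_ *+ _ - _).
  by rewrite cardsE.
rewrite [RHS]big_mkcond; apply: eq_bigr => j _.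
by rewrite sym_e; case: (e i j); rewrite ?mulr1 ?mulr0.
Qed.

Lemma tr_laplacian (R : pzRingType) n (e : rel 'I_n) :
  symmetric e -> (laplacian R e)^T = laplacian R e.
Proof.
move=> sym_e; apply/matrixP => i j; rewrite !mxE sym_e eq_sym.
by case: eqP => [->|].
Qed.

Lemma unitmx_row_neq0 (R : fieldType) n (P : 'M[R]_n) i :
  P \in unitmx -> exists j, P i j != 0.
Proof.
move=> Punit; apply/existsP; rewrite -negb_forall; apply/negP => /forallP P0.
have : row i P *m invmx P = row i 1%:M by rewrite -row_mul mulmxV.
have -> : row i P = 0 by apply/rowP => j; rewrite !mxE; exact/eqP.
rewrite mul0mx => /rowP/(_ i); rewrite !mxE eqxx => /esym/eqP.
by rewrite oner_eq0.
Qed.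

Section AlgConn.
Variables (R : realType) (n : nat) (e : rel 'I_n).
Hypotheses (n2 : (2 <= n)%N) (sym_e : symmetric e).
Local Notation s := (spectrum (laplacian R e)).

Lemma laplacian_eigenbasis :
  {in gtn n &, {homo nth 0 s : i j / (i <= j)%N >-> i <= j}} /\
  exists2 P : 'M[R]_n, P \in unitmx & forall i : 'I_n, lap_eigen e s`_i (P i).
Proof.
have [ssort ssize [P Punit PE]] := spectrum_eigenbasis _ _ _ (tr_laplacian R _ _ sym_e).
split.
  move=> i j; rewrite !inE => ni nj.
  by apply: (sorted_leq_nth le_trans lexx _ ssort); rewrite inE ssize.
exists P => // k i; rewrite -PE.
have -> : (P *m laplacian R e) k i = (row k P *m laplacian R e) 0 i.
  by rewrite -row_mul; rewrite [RHS]mxE.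
by rewrite mulmx_laplacian //; apply: eq_bigr => j _; rewrite !mxE.
Qed.

Let i0 : 'I_n := Ordinal (ltnW n2).
Let i1 : 'I_n := Ordinal n2.

Lemma eigenbasis_coord (P : 'M[R]_n) c x : P \in unitmx ->
  (forall i : 'I_n, lap_eigen e s`_i (P i)) -> lap_eigen e c x ->
  exists2 z : 'I_n -> R, (forall k : 'I_n, s`_k != c -> z k = 0) &
    forall i, x i = \sum_k z k * P k i.
Proof.
move=> Punit PE xE; pose v := \row_i x i; pose z := v *m invmx P.
have vE : v = z *m P by rewrite mulmxKV.
exists (z 0) => [k|i]; last by have /rowP/(_ i) := vE; rewrite !mxE.
have : (z *m diag_mx (\row_i s`_i)) *m P = (c *: z) *m P.
  rewrite -scalemxAl -vE -mulmxA.
  have -> : diag_mx (\row_i s`_i) *m P = P *m laplacian R e.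
    apply/row_matrixP => i; rewrite !row_mul; apply/rowP => j.
    rewrite mulmx_laplacian // row_diag_mx -scalemxAl -rowE !mxE -PE.
    by apply: eq_bigr => l _; rewrite !mxE.
  rewrite mulmxA -vE; apply/rowP => i; rewrite mulmx_laplacian // !mxE -xE.
  by apply: eq_bigr => l _; rewrite !mxE.
move=> /(congr1 (fun M => M *m invmx P)); rewrite !mulmxK //.
move=> /rowP/(_ k); rewrite mul_mx_diag !mxE mulrC => /eqP.
by rewrite -subr_eq0 -mulrBl mulf_eq0 subr_eq0 => /orP[->//|/eqP].
Qed.

(** Were the first eigenvalue positive, all would be, and the constant 1, which has eigenvalue 0,
    would have only zero coordinates. *)
Lemma spectrum_laplacian0 : s`_0 = 0.
Proof.
have [smono [P Punit PE]] := laplacian_eigenbasis.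
have s0ge := lap_eigen_ge0 R _ _ sym_e _ _ (unitmx_row_neq0 _ _ P i0 Punit) (PE i0).
apply/le_anti; rewrite s0ge andbT leNgt; apply/negP => s0gt.
have one : lap_eigen e 0 (fun=> 1 : R).
  by move=> i; rewrite big1 ?mul0r // => j _; rewrite subrr.
have [z z0 /(_ i0) oneE] := eigenbasis_coord P _ _ Punit PE one.
move: oneE; rewrite big1 => [/eqP|k _]; first by rewrite oner_eq0.
rewrite z0 ?mul0r // gt_eqF // (lt_le_trans s0gt) //.
by apply: smono => //; rewrite ?inE //=; exact: ltnW.
Qed.

(** A nonzero eigenvalue forces zero sum. If the second eigenvalue is 0, rows [i0] and [i1] both lie
    in the kernel, and some nonzero combination of them has zero sum. *)
Lemma alg_conn_eigen : exists x, zero_sum_eigen e (alg_conn R e) x.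
Proof.
have [smono [P Punit PE]] := laplacian_eigenbasis.
have [s10|s10] := eqVneq s`_1 0; last first.
  exists (P i1); split; [exact: unitmx_row_neq0| |exact: PE].
  exact: (lap_eigen_sum0 _ _ _ sym_e _ _ s10 (PE i1)).
pose t k := \sum_i P k i.
have [t1|t1] := eqVneq (t i1) 0.
  by exists (P i1); split; [exact: unitmx_row_neq0| |exact: PE].
exists (fun i => t i1 * P i0 i - t i0 * P i1 i); split.
- have [j0 Mj0] := unitmx_row_neq0 _ _ (invmx P) i0 (etrans (unitmx_inv _) Punit).
  apply/existsP; rewrite -negb_forall; apply/negP => /forallP x0.
  (* Multiplying by [invmx P] reads off the coordinate along row [i0]; it is nonzero, so the
     combination is too. *)
  have : (\row_i (t i1 * P i0 i - t i0 * P i1 i) *m invmx P) 0 i0 = t i1.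
    have -> : \row_i (t i1 * P i0 i - t i0 * P i1 i) =
        t i1 *: row i0 P - t i0 *: row i1 P by apply/rowP => i; rewrite !mxE.
    rewrite mulmxBl -!scalemxAl -!row_mul mulmxV // !mxE /=.
    by rewrite mulr1 mulr0 subr0.
  have -> : \row_i (t i1 * P i0 i - t i0 * P i1 i) = 0.
    by apply/rowP => i; rewrite !mxE; exact/eqP.
  by rewrite mul0mx mxE => /esym/eqP; apply/negP.
- by rewrite sumrB -!mulr_sumr -/(t i0) -/(t i1) mulrC subrr.
- move=> i; rewrite /alg_conn s10 mul0r.
  have E0 := PE i0 i; have E1 := PE i1 i.
  rewrite spectrum_laplacian0 mul0r in E0; rewrite s10 mul0r in E1.
  transitivity (t i1 * \sum_(j | e i j) (P i0 i - P i0 j)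
                - t i0 * \sum_(j | e i j) (P i1 i - P i1 j)).
    by rewrite !mulr_sumr -sumrB; apply: eq_bigr => j _; ring.
  by rewrite E0 E1 !mulr0 subr0.
Qed.

(** If [c] were below the second eigenvalue, [x] and the constant 1 would both be multiples of the
    first basis row. Then [x] would be constant, which a nonzero zero-sum function is not. *)
Lemma alg_conn_le c x : zero_sum_eigen e c x -> alg_conn R e <= c.
Proof.
move=> [xn0 xsum xE]; rewrite leNgt; apply/negP => cs1.
have c0 := lap_eigen_ge0 R _ _ sym_e _ _ xn0 xE.
have [smono [P Punit PE]] := laplacian_eigenbasis.
have sgt (k : 'I_n) : k != i0 -> c < s`_k.
  move=> k0; apply: (lt_le_trans cs1); apply: smono; rewrite ?inE //=.
  by rewrite lt0n -(inj_eq val_inj) in k0 *.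
have only0 y d : d <= c -> lap_eigen e d y -> exists z, forall i, y i = z * P i0 i.
  move=> dc yE; have [z z0 yz] := eigenbasis_coord P _ _ Punit PE yE.
  exists (z i0) => i; rewrite yz (bigD1 i0) //= big1 ?addr0 // => k k0.
  by rewrite z0 ?mul0r // gt_eqF // (le_lt_trans dc) // sgt.
have one : lap_eigen e 0 (fun=> 1 : R).
  by move=> i; rewrite big1 ?mul0r // => j _; rewrite subrr.
have [w wE] := only0 _ _ c0 one; have [z zE] := only0 _ _ (lexx c) xE.
have [i xi] := xn0; have w0 : w != 0.
  by apply: contraPneq (wE i) => ->; rewrite mul0r => /eqP; rewrite oner_eq0.
have xz j : x j = z / w.
  rewrite zE -[z / w]mulr1 (wE j); field; exact: w0.
move: xsum; under eq_bigr do rewrite xz.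
rewrite sumr_const card_ord => /eqP; rewrite mulrn_eq0 -(xz i) (negbTE xi) orbF.
by rewrite gtn_eqF // ltnW.
Qed.
End AlgConn.

(** * Extreme points of zero-sum eigenvectors *)

Lemma zero_sum_pos (R : realDomainType) (T : finType) (x : T -> R) :
  (exists i, x i != 0) -> \sum_i x i = 0 -> exists i, 0 < x i.
Proof.
move=> [i xi0] xsum; apply/existsP; apply: contraNT xi0.
rewrite negb_exists => /forallP xle0; apply/eqP/oppr_inj; rewrite oppr0.
apply: (psumr_eq0P (P := predT) (F := fun j => - x j)) => // [j _|].
  by rewrite oppr_ge0 leNgt.
by rewrite sumrN xsum oppr0.
Qed.

Lemma lap_eigenN (R : pzRingType) (T : finType) (e : rel T) c (x : T -> R) :
  lap_eigen e c x -> lap_eigen e c (fun i => - x i).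
Proof.
move=> xE j; rewrite mulrN -xE -sumrN; apply: eq_bigr => k _.
by rewrite opprB opprK addrC.
Qed.

Lemma zero_sum_eigenN (R : pzRingType) (T : finType) (e : rel T) c (x : T -> R) :
  zero_sum_eigen e c x -> zero_sum_eigen e c (fun i => - x i).
Proof.
move=> [[i xi] xsum xE]; split; first by exists i; rewrite oppr_eq0.
  by rewrite sumrN xsum oppr0.
exact: lap_eigenN.
Qed.

(** At a maximum the terms [x i - x j] are nonnegative and add up to [c * x i < x i], so each of
    them is below [x i]. *)
Lemma zero_sum_eigen_max (R : realFieldType) (T : finType) (e : rel T)
    (c : R) (x : T -> R) :
  c < 1 -> zero_sum_eigen e c x ->
  exists i, [/\ forall j, x j <= x i, 0 < x i & forall j, e i j -> 0 < x j].
Proof.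
move=> c1 [xn0 xsum xE]; have [i0 xi0] := zero_sum_pos _ _ _ xn0 xsum.
pose i := [arg max_(i > i0) x i]%O.
have imax j : x j <= x i by rewrite /i; case: arg_maxP => // k _; exact.
have xi : 0 < x i by rewrite (lt_le_trans xi0).
exists i; split=> // j eij; have := xE i; rewrite (bigD1 j) //=.
set S := \sum_(_ | _) _ => sumE.
have S0 : 0 <= S by apply: sumr_ge0 => k _; rewrite subr_ge0.
have : 0 < (1 - c) * x i by rewrite mulr_gt0 // subr_gt0.
lra.
Qed.

(** * Energy bound from a path on four vertices *)

Lemma sum_split4 (V : nmodType) (T : finType) (p q r s : T) (F : T -> V) :
  uniq [:: p; q; r; s] ->
  \sum_t F t =
    F p + F q + F r + F s + \sum_(t | t \notin [:: p; q; r; s]) F t.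
Proof.
move=> Q; rewrite (bigID (mem [:: p; q; r; s])) /=; congr (_ + _).
by rewrite -big_uniq //= !big_cons big_nil addr0 !addrA.
Qed.

Lemma sum_path4_le (R : realDomainType) (T : finType) (w : T -> T -> R)
    (p q r s : T) :
  (forall i j, 0 <= w i j) -> (forall i j, w i j = w j i) ->
  uniq [:: p; q; r; s] ->
  2 * (w p q + w q r + w r s +
       \sum_(j | j \notin [:: p; q; r; s]) (w j p + w j q + w j r + w j s))
    <= \sum_i \sum_j w i j.
Proof.
move=> w0 wC Q; pose out := [pred j | j \notin [:: p; q; r; s]].
pose W i := \sum_(j | out j) w i j.
have rowE i : \sum_j w i j = w i p + w i q + w i r + w i s + W i.
  exact: sum_split4.
have outE : \sum_(j | out j) (w j p + w j q + w j r + w j s) =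
    W p + W q + W r + W s.
  rewrite /W -!big_split /=; apply: eq_bigr => j _.
  by rewrite !(wC j).
have outle : \sum_(j | out j) (w j p + w j q + w j r + w j s) <=
    \sum_(j | out j) \sum_i w j i.
  apply: ler_sum => j _; rewrite rowE lerDl.
  by apply: sumr_ge0.
rewrite (sum_split4 _ _ _ _ _ _ _ Q) !rowE -/out.
move: outle outE; set A := \sum_(j | _) _; set B := \sum_(j | _) _.
have := (w0 p p, w0 p r, w0 p s, w0 q q, w0 q s, w0 r r, w0 s s, w0 r p, w0 s p, w0 s q).
have := (wC p q, wC q r, wC r s).
case=> [[-> ->] ->] [[[[[[[[[*]*]*]*]*]*]*]*]*]; lra.
Qed.

(** Energy minus [a] times the sum of squares, scaled by [1 - a] and divided by [h ^+ 2], is at most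
    0. The edge [q r] and the squares at [q], [r] give [(4 - 2 * a) * (1 - a)]; [p] and [s] give at
    least [- a] each; an outside vertex gives at least [2 * (1 - a)] if it spans and [- a]
    otherwise. *)
Lemma path4_energy_bound (R : realFieldType) (T : finType) (e : rel T)
    (a : R) (x : T -> R) (p q r s : T)
    (Q := [:: p; q; r; s])
    (spans := fun j => (e j p || e j q) && (e j r || e j s)) :
  symmetric e -> a < 1 -> zero_sum_eigen e a x -> uniq Q ->
  e p q -> e q r -> e r s -> (forall j, e j q || e j r) ->
  x q <= x p -> x s <= x r -> x r < x q ->
  (2 * #|[pred j | (j \notin Q) && spans j]|%:R + 4 - 2 * a) * (1 - a) - 2 * a
    <= a * #|[pred j | (j \notin Q) && ~~ spans j]|%:R.
Proof.
move=> sym_e a1 [xn0 xsum xE] uQ epq eqr ers dom xqp xsr xrq.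
have a0 : 0 <= a := lap_eigen_ge0 _ _ _ sym_e _ _ xn0 xE.
pose c := (x q + x r) / 2; pose z j := x j - c; pose h := (x q - x r) / 2.
have h0 : 0 < h by rewrite divr_gt0 // subr_gt0.
have zq : z q = h by rewrite /z /c /h; field.
have zr : z r = - h by rewrite /z /c /h; field.
have zp : h <= z p by rewrite -zq lerD2r.
have zs : z s <= - h by rewrite -zr lerD2r.
pose w i j := if e i j then (z i - z j) ^+ 2 else 0.
have w0 i j : 0 <= w i j by rewrite /w; case: ifP => // _; exact: sqr_ge0.
have wC i j : w i j = w j i by rewrite /w sym_e; case: ifP => // _; ring.
have energy : \sum_i \sum_j w i j <= 2 * (a * \sum_i z i ^+ 2).
  have -> : \sum_i \sum_j w i j = \sum_i \sum_(j | e i j) (x i - x j) ^+ 2.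
    apply: eq_bigr => i _; rewrite [RHS]big_mkcond; apply: eq_bigr => j _.
    by rewrite /w; case: ifP => // _; rewrite /z; ring.
  rewrite (lap_eigen_energy _ _ _ sym_e _ _ xE) ler_pM2l //.
  apply: ler_wpM2l => //.
  have -> : \sum_i z i ^+ 2 =
      \sum_i x i ^+ 2 - 2 * c * \sum_i x i + \sum_(i : T) c ^+ 2.
    rewrite mulr_sumr -sumrB -big_split; apply: eq_bigr => i _ /=.
    by rewrite /z; ring.
  rewrite xsum mulr0 subr0 lerDl; apply: sumr_ge0 => i _; exact: sqr_ge0.
have := le_trans (sum_path4_le _ _ _ _ _ _ _ w0 wC uQ) energy.
rewrite [X in a * X](sum_split4 _ _ _ _ _ _ _ uQ) -/Q.
set C := fun j => w j p + w j q + w j r + w j s.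
rewrite -/(\sum_(j | j \notin Q) C j).
have wpq : w p q = (z p - h) ^+ 2 by rewrite /w epq zq.
have wqr : w q r = 4 * h ^+ 2 by rewrite /w eqr zq zr; ring.
have wrs : w r s = (z s + h) ^+ 2 by rewrite /w ers zr; ring.
rewrite wpq wqr wrs zq zr => bound.
(* The difference of the two sides is the square of [(1 - a) u - t]. *)
have cheap u t : - a * t ^+ 2 <= (1 - a) * ((u - t) ^+ 2 - a * u ^+ 2).
  rewrite -subr_ge0.
  have -> : (1 - a) * ((u - t) ^+ 2 - a * u ^+ 2) - - a * t ^+ 2 =
    ((1 - a) * u - t) ^+ 2 by ring.
  exact: sqr_ge0.
(* The right-hand side equals [(u - t - t') ^+ 2 - 2 * t * t' + (1 - a) * u ^+ 2], and [- t * t'] is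
   at least [h ^+ 2]. *)
have costly u t t' : h <= t -> t' <= - h ->
    2 * h ^+ 2 <= (u - t) ^+ 2 + (u - t') ^+ 2 - a * u ^+ 2.
  move=> ht ht'; apply: (@le_trans _ _ ((u - t - t') ^+ 2 + 2 * (t * - t'))).
    have : h * h <= t * - t' by apply: ler_pM; lra.
    have := sqr_ge0 (u - t - t'); lra.
  have : 0 <= (1 - a) * u ^+ 2 by rewrite mulr_ge0 ?sqr_ge0 // subr_ge0 ltW.
  lra.
have wle i j : e i j -> w i j = (z i - z j) ^+ 2 by rewrite /w => ->.
have outside j : (if spans j then 2 * h ^+ 2 * (1 - a) else - a * h ^+ 2) <=
    (1 - a) * (C j - a * z j ^+ 2).
  have Cge t : w j t <= C j -> (1 - a) * (w j t - a * z j ^+ 2) <=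
      (1 - a) * (C j - a * z j ^+ 2).
    by move=> ?; apply: ler_wpM2l; rewrite ?lerB // subr_ge0 ltW.
  have wj := (w0 j p, w0 j q, w0 j r, w0 j s).
  case: ifP => [/andP[/orP pq /orP rs]|_].
    have [t [ht wt]] : exists t, h <= t /\ (z j - t) ^+ 2 <= w j p + w j q.
      case: pq => ejt; [exists (z p)|exists (z q)];
        by rewrite (wle _ _ ejt) ?lerDl ?lerDr ?zq.
    have [t' [ht' wt']] : exists t, t <= - h /\ (z j - t) ^+ 2 <= w j r + w j s.
      case: rs => ejt; [exists (z r)|exists (z s)];
        by rewrite (wle _ _ ejt) ?lerDl ?lerDr ?zr.
    rewrite mulrC; apply: ler_wpM2l; first by rewrite subr_ge0 ltW.
    have := costly (z j) t t' ht ht'; rewrite /C; lra.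
  (* A single edge, to [q] or to [r], suffices here; the others only add energy. *)
  case/orP: (dom j) => ejt; have := cheap (z j) (if e j q then h else - h).
    rewrite ejt; move/le_trans; apply; rewrite -zq -wle //; apply: Cge.
    by rewrite /C; case: wj => [[[]]]; lra.
  case: ifP => [ejq|_].
    move/le_trans; apply; rewrite -zq -wle //; apply: Cge.
    by rewrite /C; case: wj => [[[]]]; lra.
  rewrite sqrrN; move/le_trans; apply; rewrite -zr -wle //; apply: Cge.
  by rewrite /C; case: wj => [[[]]]; lra.
set M := #|_|; set K := #|_|.
have sumout : 2 * h ^+ 2 * (1 - a) * M%:R + (- a * h ^+ 2) * K%:R <=
    (1 - a) * (\sum_(j | j \notin Q) C j -
               a * \sum_(j | j \notin Q) z j ^+ 2).
  rewrite [a * \sum_(_ | _) _]mulr_sumr -sumrB mulr_sumr.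
  apply: le_trans (ler_sum _ (fun j _ => outside j)).
  rewrite (bigID spans) /= !mulr_natr -!sumr_const.
  apply: lerD; rewrite le_eqVlt; apply/orP; left; apply/eqP.
    by apply: eq_bigr => j /andP[_ ->].
  by apply: eq_bigr => j /andP[_ /negbTE->].
have Ep := cheap (z p) h; have Es := cheap (z s) (- h).
have h20 : 0 < h ^+ 2 by rewrite exprn_gt0.
rewrite -subr_ge0 -(pmulr_rge0 _ h20).
have a1' : 0 <= 1 - a by rewrite subr_ge0 ltW.
move: bound; rewrite ler_pM2l // -subr_ge0 => /(mulr_ge0 a1').
rewrite -subr_ge0 in sumout; rewrite -subr_ge0 in Ep; rewrite -subr_ge0 in Es.
move: sumout Ep Es; set A := \sum_(_ | _) _; set B := \sum_(_ | _) _.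
move=> H1 H2 H3 H4.
(* In this sum the unknown values of [z] cancel, leaving [h ^+ 2] times the claimed difference. *)
have := addr_ge0 (addr_ge0 H1 H2) (addr_ge0 H3 H4).
congr (0 <= _); ring.
Qed.

(** Suppose [t = a + b] is at most 1. After replacing [K] by [M'] and [K'] by [M], add the two
    bounds: [M] and [M'] get the nonnegative coefficients [2 * (1 - a) - b] and [2 * (1 - b) - a],
    and the constant term is [8 * (1 - t) + t ^+ 2 + (a - b) ^+ 2], which is positive. *)
Lemma counting_bound (R : realFieldType) (a b M M' K K' : R) :
  0 <= a -> 0 <= b -> a < 1 -> b < 1 -> 0 <= M -> 0 <= M' -> K <= M' -> K' <= M ->
  (2 * M + 4 - 2 * a) * (1 - a) - 2 * a <= a * K ->
  (2 * M' + 4 - 2 * b) * (1 - b) - 2 * b <= b * K' ->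
  1 < a + b.
Proof.
move=> a0 b0 a1 b1 M0 M'0 KM' K'M boundM boundM'; rewrite ltNge; apply/negP => ab.
have aKM' := ler_wpM2l a0 KM'; have bK'M := ler_wpM2l b0 K'M.
have abM : 0 <= (1 - a - b) * M by apply: mulr_ge0 => //; lra.
have abM' : 0 <= (1 - a - b) * M' by apply: mulr_ge0 => //; lra.
have aM : 0 <= (1 - a) * M by apply: mulr_ge0 => //; lra.
have bM' : 0 <= (1 - b) * M' by apply: mulr_ge0 => //; lra.
have sq : 0 <= (a - b) ^+ 2 by exact: sqr_ge0.
have sab : 0 <= (a + b) * (1 - a - b) by apply: mulr_ge0; lra.
have sq1 : 0 <= (1 - a - b) ^+ 2 by exact: sqr_ge0.
lra.
Qed.

(** * Complementary graphs with both connectivities below 1 *)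

Definition complementary {T : finType} (e e' : rel T) : Prop :=
  [/\ symmetric e, symmetric e', irreflexive e, irreflexive e' &
      forall i j, i != j -> e' i j = ~~ e i j].

Lemma complementaryC (T : finType) (e e' : rel T) :
  complementary e e' -> complementary e' e.
Proof.
by case=> ? ? ? ? ee'; split=> // i j ij; rewrite ee' // negbK.
Qed.

Lemma both_lt1_bound (R : realFieldType) (T : finType) (e e' : rel T) (a b : R)
    (x y : T -> R) : complementary e e' ->
  zero_sum_eigen e a x -> zero_sum_eigen e' b y -> a < 1 -> b < 1 -> 1 < a + b.
Proof.
move=> ee' ax bY a1 b1; have [sym_e sym_e' irr irr' eN] := ee'.
(* The extreme points are [i], [k] for [x] and [i'], [k'] for [y]; the path is [i i' k' k] in [e]
   and [i' k i k'] in [e']. *)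
have [i [imax xi Ni]] := zero_sum_eigen_max _ _ _ _ _ a1 ax.
have [k [kmin xk Nk]] := zero_sum_eigen_max _ _ _ _ _ a1 (zero_sum_eigenN _ _ _ _ _ ax).
have far_x j : e i j -> e k j = false.
  by move=> /Ni xj; apply/negP => /Nk; rewrite oppr_gt0 ltNge ltW.
have ik : i != k by apply: contraTneq xi => ->; rewrite -leNgt ltW // -oppr_gt0.
have eik : e i k = false.
  by apply/negP => /Ni; rewrite ltNge ltW // -oppr_gt0.
have Ndist u v : e u v -> u != v by apply: contraTneq => ->; rewrite irr.
have [i' [k' [i'max k'min /andP[zk' zi'] Ni' Nk']]] : exists i' k',
    [/\ forall j, y j <= y i', forall j, y k' <= y j, y k' < 0 < y i',
        forall j, e' i' j -> 0 < y j & forall j, e' k' j -> y j < 0].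
  have [i' [i'max zi' Ni']] := zero_sum_eigen_max _ _ _ _ _ b1 bY.
  have [k' [k'min zk' Nk']] :=
    zero_sum_eigen_max _ _ _ _ _ b1 (zero_sum_eigenN _ _ _ _ _ bY).
  exists i', k'; split=> // [j||j /Nk']; rewrite ?oppr_gt0 //.
    by rewrite -lerN2.
  by rewrite -oppr_gt0 zk' zi'.
have i'k' : i' != k' by apply: contraTneq zi' => ->; rewrite -leNgt ltW.
have ei'k' : e i' k'.
  apply: contraTT zk' => ei'k'; rewrite -leNgt ltW //; apply: Ni'.
  by rewrite eN.
(* A vertex adjacent to neither would be a common [e']-neighbour of [i'] and [k'], where [y] would
   be both positive and negative. *)
have dom j : e j i' || e j k'.
  have [->|ji'] := eqVneq j i'; first by rewrite ei'k' orbT.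
  have [->|jk'] := eqVneq j k'; first by rewrite sym_e ei'k'.
  rewrite -[X in X || _]negbK -[X in _ || X]negbK -!eN // ![e' j _]sym_e'.
  rewrite -negb_and; apply/negP => /andP[/Ni' zj /Nk'].
  by rewrite ltNge ltW.
(* By [dom], [i] is adjacent to [i'] or [k']; negating [y] exchanges these two. *)
wlog eii' : y i' k' bY i'max k'min zk' zi' Ni' Nk' i'k' ei'k' dom / e i i'.
  move=> wl; case/orP: (dom i) => [eii'|eik'].
    exact: (wl y i' k').
  apply: (wl (fun j => - y j) k' i') => //.
  - exact: zero_sum_eigenN.
  - by move=> j; rewrite lerN2.
  - by move=> j; rewrite lerN2.
  - by rewrite oppr_lt0.
  - by rewrite oppr_gt0.
  - by move=> j /Nk'; rewrite oppr_gt0.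
  - by move=> j /Ni'; rewrite oppr_lt0.
  - by rewrite eq_sym.
  - by rewrite sym_e.
  - by move=> j; rewrite orbC.
have eki' := far_x _ eii'.
have ekk' : e k k' by have := dom k; rewrite eki'.
have eik' : e i k' = false by apply/negP => /far_x; rewrite ekk'.
have ek'i : e k' i = false by rewrite sym_e.
have xi' := Ni _ eii'; have xk' : x k' < 0 by rewrite -oppr_gt0 Nk.
have i'k : i' != k by apply: contraTneq xi' => ->; rewrite -leNgt ltW // -oppr_gt0.
have ik' : i != k' by apply: contraTneq xk' => <-; rewrite -leNgt ltW.
have e'i'k : e' i' k by rewrite eN // sym_e eki'.
have e'ik' : e' i k' by rewrite eN // eik'.
have e'ik : e' i k by rewrite eN // eik.
have dom' j : e' j k || e' j i.
  have [->|jk] := eqVneq j k; first by rewrite sym_e' e'ik orbT.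
  have [->|ji] := eqVneq j i; first by rewrite e'ik.
  rewrite !eN // -negb_and; apply/andP => -[]; rewrite sym_e => ekj.
  by rewrite sym_e => /far_x; rewrite ekj.
have ii' := Ndist _ _ eii'; have kk' := Ndist _ _ ekk'.
have uQ : uniq [:: i; i'; k'; k].
  by rewrite /= !inE !negb_or ii' ik' ik i'k' i'k eq_sym kk'.
have uQ' : uniq [:: i'; k; i; k'].
  by rewrite /= !inE !negb_or i'k eq_sym ii' i'k' eq_sym ik kk' ik'.
have xki : x k <= x k' by rewrite -lerN2.
have bound := path4_energy_bound _ _ _ _ _ _ _ _ _ sym_e a1 ax uQ eii' ei'k'
  (etrans (sym_e _ _) ekk') dom (imax _) xki (lt_trans xk' xi').
have zik : y i < y k.
  by apply: (@lt_trans _ _ 0); [apply: Nk'; rewrite sym_e' | exact: Ni'].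
have bound' := path4_energy_bound _ _ _ _ _ _ _ _ _ sym_e' b1 bY uQ' e'i'k
  (etrans (sym_e' _ _) e'ik) e'ik' dom' (i'max _) (k'min _) zik.
apply: (counting_bound _ _ _ _ _ _ _ _ _ a1 b1 _ _ _ _ bound bound') => //.
- by case: ax => xn0 _ xE; exact: (lap_eigen_ge0 _ _ _ sym_e _ _ xn0 xE).
- by case: bY => zn0 _ zE; exact: (lap_eigen_ge0 _ _ _ sym_e' _ _ zn0 zE).
(* A vertex that does not span in [e] misses both [i] and [i'], or both [k] and [k']. In [e'] it is
   adjacent to both of them, and these two lie in different pairs among [{i', k}] and [{i, k'}]. *)
- rewrite ler_nat; apply/subset_leq_card/subsetP => j; rewrite !inE !negb_or.
  case/andP=> /and4P[ji ji' jk' jk]; rewrite ji ji' jk jk' !eN //=.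
  by case: (e j i); case: (e j i'); case: (e j k); case: (e j k').
- rewrite ler_nat; apply/subset_leq_card/subsetP => j; rewrite !inE !negb_or.
  case/andP=> /and4P[ji' jk ji jk']; rewrite ji ji' jk jk' !eN //=.
  by case: (e j i); case: (e j i'); case: (e j k); case: (e j k').
Qed.

(** The join condition without a second vertex type: [v] is the apex, and the cut [S] certifies that
    the graph is disconnected once [v] is deleted. *)
Definition cone_over_disconnected {T : finType} (e : rel T) (v : T)
    (S : pred T) : Prop :=
  [/\ forall j, j != v -> e v j,
      exists s t, [/\ s != v, t != v, S s & ~~ S t] &
      forall s t, s != v -> t != v -> e s t -> S s = S t].

(** * Equality case: eigenvalue 1 of a join *)

Section Equality.
Variables (R : realFieldType) (T : finType).
Implicit Types (e : rel T) (x y : T -> R) (S : {set T}).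

Lemma join_eigen1_le e x S :
  (forall s t, s \in S -> t \notin S -> e s t) -> lap_eigen e 1 x ->
  (0 < #|~: S|)%N -> forall s, s \in S ->
  (#|~: S|%:R - 1) * x s <= \sum_(t in ~: S) x t.
Proof.
move=> joined xE m0 s0 s0S; set m : R := #|~: S|%:R.
have m1 : 0 <= m - 1 by rewrite subr_ge0 ler1n.
pose s := [arg max_(s > s0 in S) x s]%O.
have [sS smax] : s \in S /\ forall t, t \in S -> x t <= x s.
  by rewrite /s; case: arg_maxP.
apply: (le_trans (ler_wpM2l m1 (smax _ s0S))).
have := xE s; rewrite (bigID (mem S)) /= mul1r.
have -> : \sum_(j | e s j && (j \notin S)) (x s - x j) =
    m * x s - \sum_(t in ~: S) x t.
  rewrite mulr_natl -sumr_const -sumrB; apply: eq_bigl => j; rewrite inE.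
  by case jS: (j \in S); rewrite ?andbF // joined ?jS.
have : 0 <= \sum_(j | e s j && (j \in S)) (x s - x j).
  by apply: sumr_ge0 => j /andP[_ jS]; rewrite subr_ge0 smax.
lra.
Qed.

(** The previous bound for [x] and [- x] gives [(m - 1) * x s = tau] on [S]. Summing over [S], where
    [x] adds up to [- tau], gives [(#|S| + m - 1) * tau = 0]. *)
Lemma join_eigen1 e x S :
  (forall s t, s \in S -> t \notin S -> e s t) -> lap_eigen e 1 x ->
  \sum_i x i = 0 -> (0 < #|S|)%N -> (0 < #|~: S|)%N ->
  \sum_(t in ~: S) x t = 0 /\
  (#|~: S| != 1%N -> forall s, s \in S -> x s = 0).
Proof.
move=> joined xE xsum S0 m0; set tau := \sum_(t in ~: S) x t.
set m : R := #|~: S|%:R.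
have xNE := lap_eigenN _ _ _ _ _ xE.
have xS s : s \in S -> (m - 1) * x s = tau.
  move=> sS; apply/le_anti; rewrite (join_eigen1_le _ _ _ joined xE m0 _ sS) /=.
  have := join_eigen1_le _ _ _ joined xNE m0 _ sS.
  by rewrite sumrN mulrN lerN2.
have tau0 : tau = 0.
  have sumS : \sum_(s in S) x s = - tau.
    apply/eqP; rewrite -addr_eq0; move/eqP: xsum.
    rewrite (bigID (mem S)) /=; congr (_ + _ == _).
    by apply: eq_bigl => j; rewrite inE.
  have : \sum_(s in S) (m - 1) * x s = #|S|%:R * tau.
    by rewrite (eq_bigr (fun=> tau)) // sumr_const mulr_natl.
  rewrite -mulr_sumr sumS => /eqP.
  rewrite -subr_eq0 mulrN -opprD oppr_eq0 -mulrDl mulf_eq0 => /orP[|/eqP//].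
  have : 0 < (#|S|%:R : R) by rewrite ltr0n.
  have : 1 <= m by rewrite ler1n.
  by move=> ? ? /eqP; lra.
split=> // m1 s sS; have /eqP := xS s sS.
by rewrite tau0 mulf_eq0 subr_eq0 pnatr_eq1 (negbTE m1) => /eqP.
Qed.

Lemma apex_eigen1_cone e x v : symmetric e -> irreflexive e ->
  (forall j, j != v -> e v j) -> zero_sum_eigen e 1 x -> x v = 0 ->
  cone_over_disconnected e v (fun j => 0 < x j).
Proof.
move=> sym_e irr apex x1 xv; have [xn0 xsum xE] := x1.
split=> //.
  have [s xs] := zero_sum_pos _ _ _ xn0 xsum.
  have [xNn0 xNsum _] := zero_sum_eigenN _ _ _ _ _ x1.
  have [t xt] := zero_sum_pos _ _ _ xNn0 xNsum; rewrite oppr_gt0 in xt.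
  exists s, t; split=> //; last by rewrite -leNgt ltW.
    by apply: contraTneq xs => ->; rewrite xv ltxx.
  by apply: contraTneq xt => ->; rewrite xv ltxx.
move=> s t sv tv est; congr (0 < _).
(* Deleting the apex, where x vanishes, lowers the eigenvalue from 1 to 0. *)
pose e0 : rel T := fun i j => [&& i != v, j != v & e i j].
have sym_e0 : symmetric e0 by move=> i j; rewrite /e0 sym_e andbCA.
apply: (lap_eigen0_edge _ _ e0 sym_e0); last by rewrite /e0 sv tv.
move=> i; rewrite mul0r; have [->|iv] := eqVneq i v.
  by rewrite big_pred0 // => j; rewrite /e0 eqxx.
have := xE i; rewrite (bigD1 v) ?[e i v]sym_e ?apex //= xv subr0 mul1r.
move=> /eqP; rewrite addrC -subr_eq0 addrK => /eqP sum0.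
by rewrite -[RHS]sum0; apply: eq_bigl => j; rewrite /e0 iv andTb andbC.
Qed.

(** Since [y] is constant along [e']-edges, its positive set [S] is joined in [e] to the rest. If
    neither side is a singleton, [join_eigen1] used both ways makes [x] vanish; a singleton side is
    an apex where [x] is 0. *)
Lemma eigen1_eigen0_cone e e' x y : complementary e e' ->
  zero_sum_eigen e 1 x -> zero_sum_eigen e' 0 y ->
  exists v (S : pred _), cone_over_disconnected e v S.
Proof.
move=> [sym_e sym_e' irr irr' eN] x1 [yn0 ysum yE].
have [xn0 xsum xE] := x1.
pose S := [set j | 0 < y j].
have joined s t : s \in S -> t \notin S -> e s t.
  rewrite !inE => ys yt.
  have st : s != t by apply: contraNneq yt => <-.
  apply: contraNT yt; rewrite -eN // => /(lap_eigen0_edge _ _ _ sym_e' _ _ _ yE).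
  by move=> <-.
have joinedC s t : s \in ~: S -> t \notin ~: S -> e s t.
  by rewrite !inE negbK => ys yt; rewrite sym_e joined ?inE.
have S0 : (0 < #|S|)%N.
  have [s ys] := zero_sum_pos _ _ _ yn0 ysum.
  by apply/card_gt0P; exists s; rewrite inE.
have SC0 : (0 < #|~: S|)%N.
  have yNn0 : exists i, - y i != 0 by have [i yi] := yn0; exists i; rewrite oppr_eq0.
  have [|s] := zero_sum_pos _ _ (fun i => - y i) yNn0; first by rewrite sumrN ysum oppr0.
  rewrite oppr_gt0 => ys.
  by apply/card_gt0P; exists s; rewrite !inE -leNgt ltW.
have [tauC xS] := join_eigen1 _ _ _ joined xE xsum S0 SC0.
have := join_eigen1 _ _ _ joinedC xE xsum SC0.
rewrite setCK => /(_ S0)[tau xSC].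
have single U v : U = [set v] -> (forall s t, s \notin U -> t \in U -> e s t) ->
    \sum_(t in U) x t = 0 -> exists v (S : pred _), cone_over_disconnected e v S.
  move=> -> joinU; rewrite big_set1 => xv; exists v, (fun j => 0 < x j).
  apply: apex_eigen1_cone => // j jv.
  by rewrite sym_e joinU ?inE.
have [/cards1P[v SE]|S1] := boolP (#|S| == 1%N).
  by apply: (single _ _ SE) => // s t sS tS; rewrite joinedC // in_setC ?negbK.
have [/cards1P[v SE]|SC1] := boolP (#|~: S| == 1%N).
  by apply: (single _ _ SE) => // s t; rewrite !inE negbK => sS tS; rewrite joined ?inE.
have [i /eqP[]] := xn0.
by have [iS|iS] := boolP (i \in S); [apply: xS|apply: xSC; rewrite // in_setC].
Qed.

Lemma cone_eigen1 e v (S : pred T) : irreflexive e -> symmetric e ->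
  cone_over_disconnected e v S -> exists x : T -> R, zero_sum_eigen e 1 x.
Proof.
move=> irr sym_e [apex [s [t [sv tv Ss St]]] Sedge].
(* Giving each side of the cut the size of the other, with opposite signs, makes the sum zero. Off
   the apex, only the edge to [v] contributes. *)
pose a : R := #|[pred j | (j != v) && S j]|%:R.
pose b : R := #|[pred j | (j != v) && ~~ S j]|%:R.
pose x j : R := if j == v then 0 else if S j then b else - a.
have a0 : 0 < a by rewrite ltr0n; apply/card_gt0P; exists s; rewrite inE sv.
have b0 : 0 < b by rewrite ltr0n; apply/card_gt0P; exists t; rewrite inE tv.
have xv : x v = 0 by rewrite /x eqxx.
have xsum1 : \sum_(j | j != v) x j = 0.
  rewrite (bigID S) /=.
  rewrite (eq_bigr (fun=> b)) => [|j /andP[/negbTE jv Sj]]; last by rewrite /x jv Sj.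
  rewrite [X in _ + X](eq_bigr (fun=> - a)); last first.
    by move=> j /andP[/negbTE jv /negbTE Sj]; rewrite /x jv Sj.
  by rewrite !sumr_const -[b *+ _]mulr_natr -[- a *+ _]mulr_natr -/a -/b; ring.
exists x; split.
- by exists s; rewrite /x (negbTE sv) Ss gt_eqF.
- by rewrite (bigD1 v) //= xv add0r.
move=> i; have [->|iv] := eqVneq i v.
  rewrite xv mulr0; apply/oppr_inj; rewrite oppr0 -sumrN -[RHS]xsum1.
  apply: eq_big => [j|j _].
    by have [->|jv] := eqVneq j v; rewrite ?irr ?apex.
  by rewrite sub0r opprK.
rewrite (bigD1 v) /= ?[e i v]sym_e ?apex // xv subr0 mul1r big1 ?addr0 //.
move=> j /andP[eij jv]; apply/eqP; rewrite subr_eq0; apply/eqP.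
by rewrite /x (negbTE iv) (negbTE jv) (Sedge _ _ iv jv eij).
Qed.

(** The apex is isolated in [e'], so functions constant off [v] are in the kernel; the value at [v]
    balances the sum. *)
Lemma cone_compl_eigen0 e e' v (S : pred T) : complementary e e' ->
  cone_over_disconnected e v S -> exists y : T -> R, zero_sum_eigen e' 0 y.
Proof.
move=> [sym_e sym_e' irr irr' eN] [apex [s [_ [sv _ _ _]]] _].
exists (fun j => if j == v then #|T|%:R - 1 else - 1); split.
- by exists s; rewrite (negbTE sv) oppr_eq0 oner_eq0.
- rewrite (bigD1 v) //= eqxx (eq_bigr (fun=> - 1)) => [|j /negbTE->//].
  rewrite sumr_const cardC1 -[(- 1) *+ _]mulr_natr mulN1r.
  have : (0 < #|T|)%N by apply/card_gt0P; exists v.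
  by case: #|T| => // m _; rewrite /= -[m.+1]addn1 natrD addrK subrr.
move=> i; rewrite mul0r big1 // => j.
have [->|iv] := eqVneq i v.
  have [->|jv] := eqVneq j v; first by rewrite irr'.
  by rewrite eN 1?eq_sym // apex.
have [->|jv] := eqVneq j v; last by rewrite subrr.
by rewrite eN // sym_e apex.
Qed.

End Equality.

(** From a join, the cut is the component in [H] of a vertex that does not reach all others, pulled
    back along [f]. Conversely, [lift v] enumerates the vertices other than [v], and [S] is closed
    under the edges of the induced [H]. *)
Lemma join_K1_disconnectedP n (e : rel 'I_n) : simple_graph e ->
  join_K1_disconnected e <-> exists v (S : pred _), cone_over_disconnected e v S.
Proof.
move=> [sym_e irr]; split.
  move=> [H [[symH irrH] [nconn [f [[g fK gK] fE]]]]].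
  have /existsP[p /existsP[q pq]] : [exists p, exists q, ~~ connect H p q].
    apply: contra_notT nconn => none p q; apply: contraNT none => pq.
    by apply/existsP; exists p; apply/existsP; exists q.
  have fv : f (g (inl tt)) = inl tt by rewrite gK.
  have fr j : j != g (inl tt) -> exists r, f j = inr r.
    move=> jv; case E: (f j) => [[]|r]; last by exists r.
    by rewrite -(inj_eq (can_inj fK)) E fv eqxx in jv.
  exists (g (inl tt)), (fun j => if f j is inr r then connect H p r else false).
  split.
  - by move=> j /fr[r fj]; rewrite -fE fv fj.
  - exists (g (inr p)), (g (inr q)); rewrite !(inj_eq (can_inj gK)) !gK.
    by split=> //; exact: connect0.
  - move=> s t /fr[r fs] /fr[r' ft]; rewrite -fE fs ft /= => Hrr'.
    apply/idP/idP => conn; apply: (connect_trans conn); apply: connect1 => //.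
    by rewrite symH.
move=> [v [S [apex [s [t [sv tv Ss St]]] Sedge]]].
pose H : rel 'I_n.-1 := fun p q => e (lift v p) (lift v q).
exists H; split; first by split=> [p q|p]; rewrite /H // irr.
split.
  have lifted j : j != v -> exists p, j = lift v p.
    by move=> jv; case: (unliftP v j) jv => [p ->|->]; [exists p|rewrite eqxx].
  have [[p sE] [q tE]] := (lifted s sv, lifted t tv).
  have Hclosed : closed H [pred r | S (lift v r)].
    by move=> r r' Hrr'; rewrite !inE; apply: Sedge; rewrite // eq_sym neq_lift.
  move=> /(_ p q) /(closed_connect Hclosed); rewrite !inE -sE -tE Ss.
  by rewrite (negbTE St).
exists (fun j => if unlift v j is Some p then inr p else inl tt).
split.
  exists (fun u => match u with inl _ => v | inr p => lift v p end).
    by move=> j; case: unliftP => [p ->|->].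
  by case=> [[]|p]; rewrite ?unlift_none ?liftK.
move=> i j; case: unliftP => [p ->|->]; case: unliftP => [q ->|->] //=.
- by rewrite sym_e apex // eq_sym neq_lift.
- by rewrite apex // eq_sym neq_lift.
Qed.

(** * The inequality and its equality case for algebraic connectivity *)

Lemma compl_graph_complementary n (e : rel 'I_n) : simple_graph e ->
  complementary e (compl_graph e).
Proof.
move=> [sym_e irr]; split=> //.
- by move=> i j; rewrite /compl_graph sym_e eq_sym.
- by move=> i; rewrite /compl_graph eqxx.
- by move=> i j ij; rewrite /compl_graph ij.
Qed.

Lemma alg_conn_ge0 (R : realType) n (e : rel 'I_n) :
  (2 <= n)%N -> symmetric e -> 0 <= alg_conn R e.
Proof.
move=> n2 sym_e; have [x [xn0 _ xE]] := alg_conn_eigen R n e n2 sym_e.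
exact: (lap_eigen_ge0 _ _ _ sym_e _ _ xn0 xE).
Qed.

Lemma alg_conn_compl_ge1 (R : realType) n (e e' : rel 'I_n) : (2 <= n)%N ->
  complementary e e' -> 1 <= alg_conn R e + alg_conn R e'.
Proof.
move=> n2 ee'; have [sym_e sym_e' _ _ _] := ee'.
have a0 := alg_conn_ge0 R _ _ n2 sym_e; have b0 := alg_conn_ge0 R _ _ n2 sym_e'.
have [a1|a1] := leP 1 (alg_conn R e); first lra.
have [b1|b1] := leP 1 (alg_conn R e'); first lra.
have [x ax] := alg_conn_eigen R n e n2 sym_e.
have [y bY] := alg_conn_eigen R n e' n2 sym_e'.
exact/ltW/(both_lt1_bound _ _ _ _ _ _ _ _ ee' ax bY a1 b1).
Qed.

(** The explicit eigenvectors bound the two connectivities by 1 and 0, and the general lower bound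
    supplies the other inequality. *)
Lemma cone_alg_conn (R : realType) n (e e' : rel 'I_n) v (S : pred 'I_n) :
  (2 <= n)%N -> complementary e e' -> cone_over_disconnected e v S ->
  alg_conn R e + alg_conn R e' = 1.
Proof.
move=> n2 ee' cone; have [sym_e sym_e' irr _ _] := ee'.
apply/le_anti; rewrite alg_conn_compl_ge1 // andbT.
have [x x1] := cone_eigen1 R _ _ _ _ irr sym_e cone.
have [y y0] := cone_compl_eigen0 R _ _ _ _ _ ee' cone.
have := alg_conn_le R n e n2 sym_e _ _ x1.
have := alg_conn_le R n e' n2 sym_e' _ _ y0.
lra.
Qed.

Lemma alg_conn_eq1_cone (R : realType) n (e e' : rel 'I_n) : (2 <= n)%N ->
  complementary e e' -> alg_conn R e + alg_conn R e' = 1 ->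
  1 <= alg_conn R e -> exists v (S : pred _), cone_over_disconnected e v S.
Proof.
move=> n2 ee' ab1 a1; have [sym_e sym_e' _ _ _] := ee'.
have b0 := alg_conn_ge0 R _ _ n2 sym_e'.
have [x ax] := alg_conn_eigen R n e n2 sym_e.
have [y bY] := alg_conn_eigen R n e' n2 sym_e'.
have aE : alg_conn R e = 1 by lra.
have bE : alg_conn R e' = 0 by lra.
by rewrite aE in ax; rewrite bE in bY; exact: (eigen1_eigen0_cone _ _ _ _ _ _ ee' ax bY).
Qed.

Theorem theorem1 (R : realType) (n : nat) (e : rel 'I_n) :
  (2 <= n)%N -> simple_graph e ->
  1 <= alg_conn R e + alg_conn R (compl_graph e) /\
  (alg_conn R e + alg_conn R (compl_graph e) = 1 <->
     join_K1_disconnected e \/ join_K1_disconnected (compl_graph e)).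
Proof.
move=> n2 simple_e; have ee' := compl_graph_complementary _ _ simple_e.
have e'e := complementaryC _ _ _ ee'.
have [sym_e sym_e' _ irr' _] := ee'.
have simple_e' : simple_graph (compl_graph e) by [].
split; first exact: alg_conn_compl_ge1.
split=> [ab1|[|]].
- have [a1|a1] := leP 1 (alg_conn R e).
    left; apply/join_K1_disconnectedP => //.
    exact: (alg_conn_eq1_cone _ _ _ _ n2 ee' ab1 a1).
  have [b1|b1] := leP 1 (alg_conn R (compl_graph e)).
    right; apply/join_K1_disconnectedP => //.
    by apply: (alg_conn_eq1_cone _ _ _ _ n2 e'e _ b1); rewrite addrC.
  (* With both connectivities below 1 the bound is strict, contradicting equality. *)
  have [x ax] := alg_conn_eigen R n e n2 sym_e.
  have [y bY] := alg_conn_eigen R n _ n2 sym_e'.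
  have := both_lt1_bound _ _ _ _ _ _ _ _ ee' ax bY a1 b1.
  by rewrite ab1 ltxx.
- move=> /(join_K1_disconnectedP _ _ simple_e)[v [S cone]].
  exact: (cone_alg_conn _ _ _ _ _ _ n2 ee' cone).
- move=> /(join_K1_disconnectedP _ _ simple_e')[v [S cone]].
  by rewrite addrC; exact: (cone_alg_conn _ _ _ _ _ _ n2 e'e cone).
Qed.
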